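(* Let $n\ge 0$ be an integer and let $M$ be a compact metric space with covering dimension $\dim M\geq n$. Suppose $f:A\to M$ is a continuous mapping of a closed subspace $A$ of $\mathbb{R}$ onto the space $M$. Then there exist $n+1$ points $x_0<x_1<\dots<x_n$ of $A$ such that $$f(x_0)=f(x_2)=\dots=f(x_{2\lfloor n/2\rfloor})$$ and $$f(x_1)=f(x_3)=\dots=f(x_{2\lceil n/2\rceil-1}).$$
   Context: Covering dimension: the order of a family $\mathcal A$ of sets is the largest integer $m$ such that $\mathcal A$ contains $m+1$ sets with non-empty intersection ($\infty$ if there is no such integer). For an integer $m\ge -1$, $\dim M\le m$ means that every finite open cover of $M$ has a finite open refinement of order $\le m$; $\dim M$ is the least such $m$, or $\infty$ if none exists; $\dim\emptyset=-1$. The two displayed chains say that $f$ takes one common value at all $x_i$ with $i$ even, and one common value at all $x_i$ with $i$ odd ($0\le i\le n$); for $n=0$ the second condition is empty. *)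

(* Defs.v *)
From mathcomp Require Import all_boot all_order all_algebra.
From mathcomp Require Import all_classical all_reals all_analysis.
Import Order.TTheory GRing.Theory Num.Theory.
Import numFieldNormedType.Exports.

Set Implicit Arguments.
Unset Strict Implicit.
Unset Printing Implicit Defensive.

Local Open Scope classical_set_scope.
Local Open Scope ring_scope.

(* Orders and dimensions are extended integers, of type [\bar int].  The
   supremum of a set of integers that is nonempty and bounded above is its
   largest element, and it is +oo if the set is unbounded; dually for the
   infimum, which is +oo for the empty set. *)

(* The empty subfamily (k = 0) is allowed and has intersection [setT]: over an
   inhabited type, a family without nonempty members has order -1; over an
   empty type every family has order -oo. *)
Definition family_order (T : Type) (A : set (set T)) : \bar int :=
  supremum -oo%E [set (k%:Z - 1)%:E | k in [set k : nat |
    exists B : set (set T),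
      [/\ B `<=` A, (B #= `I_k)%card & \bigcap_(X in B) X !=set0]]].

Definition finite_open_cover (T : topologicalType) (U : set (set T)) : Prop :=
  [/\ finite_set U, U `<=` open & \bigcup_(X in U) X = [set: T]].

Definition refines (T : Type) (V U : set (set T)) : Prop :=
  forall X, V X -> exists2 Y, U Y & X `<=` Y.

Definition covdim_le (T : topologicalType) (m : int) : Prop :=
  forall U : set (set T), finite_open_cover U ->
    exists V : set (set T),
      [/\ finite_open_cover V, refines V U & (family_order V <= m%:E)%E].

(* This is -1 for the empty space, which satisfies [covdim_le T (-1)]. *)
Definition covdim (T : topologicalType) : \bar int :=
  infimum +oo%E [set m%:E | m in [set m : int | -1 <= m /\ covdim_le T m]].

(* Main.v *)
(* Suppose there is no alternation of length n+1.  A fibre of f with n+1 points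
   would be one, so fibres have at most n points; moreover the points lying on
   fibres with exactly n points form a countable set, because two such fibres
   separated by the same rationals would alternate n+1 times.  Hence a segment
   can be cut into short pieces at points that avoid this countable set and lie
   on distinct fibres, and then a point of M belongs to the images of at most n
   pieces: these images are a closed cover of order at most n-1.  As A need not
   be compact, the countable closed sum theorem is proved along the way: an open
   cover is shrunk successively so that its closures have order at most n-1 on
   the image of the part of A in [-k, k], for k = 0, 1, 2, ...; the intersections
   of these closures form a closed cover, which is thickened to an open one. *)

Require Import Defs.
From mathcomp Require Import all_boot all_order all_algebra.
From mathcomp Require Import all_classical all_reals all_analysis.
From mathcomp Require Import lra zify.
Import Order.TTheory GRing.Theory Num.Theory.
Import numFieldNormedType.Exports.

Local Open Scope classical_set_scope.
Local Open Scope ring_scope.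

(** * Multiplicity, Lebesgue numbers and swelling of finite closed families *)

Definition mult {M : Type} {J : finType} (H : J -> set M) (x : M) : nat :=
  #|[pred j | x \in H j]|.

Lemma mult_le {M : Type} {J : finType} {H G : J -> set M} {x y : M} :
  (forall j, H j x -> G j y) -> (mult H x <= mult G y)%N.
Proof.
move=> HG; apply/subset_leq_card/fintype.subsetP => j; rewrite !inE; exact: HG.
Qed.

(** [Q] is an arbitrary hereditary local property, so that one compactness argument serves open
    covers of [M], their pullbacks along [f] and the bookkeeping in [closed_swell]. *)
Lemma lebesgue_number {R : realType} {X : pseudoMetricType R} {K : set X}
    {Q : set X -> Prop} :
    compact K -> (forall B C, B `<=` C -> Q C -> Q B) ->
    (forall x, K x -> exists2 N, nbhs x N & Q N) ->
  exists2 e : R, 0 < e & forall x, K x -> Q (ball x e).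
Proof.
move=> /compact_near_coveringP cK Qmono locQ.
have /(_ R 0^'+ (fun e x => Q (ball x e)) _) := cK.
case.
  move=> x /locQ[N /nbhs_ballP[d /= d0 dN] QN].
  have d20 : 0 < d / 2 by rewrite divr_gt0.
  near=> x' e => /=; apply: Qmono QN => z x'z; apply: dN.
  rewrite (splitr d); apply: (@ball_triangle _ _ x').
    by near: x'; exact: nbhsx_ballx.
  apply: le_ball x'z; near: e; exact: nbhs_right_ltW.
move=> e /= e0 H; exists (e / 2); first by rewrite divr_gt0.
move=> x Kx; apply: (H (e / 2)) => //=; last by rewrite divr_gt0.
by rewrite sub0r normrN gtr0_norm ?divr_gt0// ltr_pdivrMr// ltr_pMr// ltr1n.
Unshelve. all: by end_near. Qed.

(* The witness y shows that no new intersections appear among the thickened sets;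
   F keeps track of the part of M where the multiplicity of G is controlled. *)
Lemma closed_swell {R : realType} {M : metricType R} {J : finType}
    {F : set M} {G U : J -> set M} :
    compact [set: M] -> closed F -> (forall j, closed (G j)) ->
    (forall j, open (U j)) -> (forall j, G j `<=` U j) ->
  exists W : J -> set M,
    [/\ forall j, open (W j), forall j, G j `<=` W j,
        forall j, closure (W j) `<=` U j
      & forall x, exists y, (F x -> F y) /\ forall j, closure (W j) x -> G j y].
Proof.
move=> cM cF cG oU GU.
pose Q (B : set M) := exists y, (F y \/ B `<=` ~` F) /\
  forall j z, B z -> G j z -> G j y /\ B `<=` U j.
have [B C BC [y [Fy Gy]]|x _|e e0 Qe] := @lebesgue_number R M [set: M] Q cM.
- exists y; split; first by case: Fy => [|CF]; [left | right => z /BC /CF].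
  by move=> j z /BC Cz Gz; have [? CU] := Gy j z Cz Gz; split=> // w /BC /CU.
- exists ([set z | ~ F x -> ~ F z] `&`
          [set z | forall j, (G j x -> U j z) /\ (~ G j x -> ~ G j z)]).
    apply: filterI.
      case: (pselect (F x)) => Fx; first by apply: filterS filterT => z _.
      have : nbhs x (~` F).
        by apply: open_nbhs_nbhs; split=> //; exact: closed_openC.
      by apply: filterS => z nFz.
    apply: filter_forall => j; case: (pselect (G j x)) => Gx.
      have : nbhs x (U j) by apply: open_nbhs_nbhs; split=> //; exact: GU.
      by apply: filterS => z.
    have : nbhs x (~` G j).
      by apply: open_nbhs_nbhs; split=> //; exact: closed_openC.
    by apply: filterS => z.
  exists x; split.
    by case: (pselect (F x)) => [|nF]; [left | right => z [] /(_ nF)].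
  move=> j z [_ /(_ j)[_ GzN]] Gz; have Gx : G j x by apply: contrapT => /GzN.
  by split=> // w [_ /(_ j)[/(_ Gx)]].
have e20 : 0 < e / 2 by rewrite divr_gt0.
pose W j := (\bigcup_(g in G j) ball g (e / 2))^°.
have clW j x : closure (W j) x -> exists2 g, G j g & ball x e g.
  move=> /(_ _ (nbhsx_ballx _ _ e20)) [w [/interior_subset[g Gg gw] xw]].
  exists g => //; rewrite (splitr e); apply: (ball_triangle xw); exact: ball_sym.
exists W; split.
- move=> j; exact: open_interior.
- move=> j g Gg; have : nbhs g (ball g (e / 2)) by exact: nbhsx_ballx.
  by apply: filterS => w gw; exists g.
- move=> j x /clW[g Gg xg]; have [y [_ /(_ j g xg Gg) [_]]] := Qe x I; apply.
  exact: ballxx.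
- move=> x; have [y [Fy Gy]] := Qe x I; exists y; split.
    by move=> Fx; case: Fy => // /(_ x); case=> //; exact: ballxx.
  by move=> j /clW[g Gg xg]; have [] := Gy j g xg Gg.
Qed.

(** * Bounding the covering dimension by closed covers *)

Lemma supremum_le {d} {T : orderType d} {x0 m : T} {A : set T} :
  (x0 <= m)%O -> ubound A m -> (supremum x0 A <= m)%O.
Proof.
move=> x0m Am; rewrite /supremum; case: ifP => // _.
by case: xgetP => // y _ [_]; apply.
Qed.

Lemma covdim_le_bound {T : topologicalType} {n : nat} :
  covdim_le T (n%:Z - 1) -> (covdim T <= (n%:Z - 1)%:E)%E.
Proof.
move=> Tn; set S := [set m%:E | m in [set m : int | -1 <= m /\ covdim_le T m]].
have SE k : covdim_le T (k%:Z - 1) -> S (k%:Z - 1)%:E.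
  by move=> Tk; exists (k%:Z - 1) => //=; split=> //; lia.
have exk : exists k : nat, `[< covdim_le T (k%:Z - 1) >] by exists n; apply/asboolP.
have [k /asboolP Tk kmin] := ex_minnP exk.
(* [infimum] is a choice with a default, so an infimum has to be exhibited: admissible dimensions
   are at least -1, and the least natural [k] yields it. *)
have infS : infimums S (k%:Z - 1)%:E.
  split; last by move=> y; apply; exact: SE.
  move=> _ [m [m1 Tm] <-]; rewrite lee_fin.
  have mE : m = (absz (m + 1))%:Z - 1 by lia.
  have : (k <= absz (m + 1)%R)%N by apply: kmin; apply/asboolP; rewrite -mE.
  by lia.
rewrite /covdim -/S /infimum ifF; last first.
  by apply/negbTE/set0P; exists (n%:Z - 1)%:E; exact: SE.
case: xgetP => [y _ [yS _]|/(_ _ infS)//]; apply: yS; exact: SE.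
Qed.

Lemma family_order_range {M : Type} {J : finType} {W : J -> set M} {n : nat} :
  (forall x, (mult W x <= n)%N) -> (family_order (range W) <= (n%:Z - 1)%:E)%E.
Proof.
move=> Wn; apply: supremum_le; first exact: leNye.
move=> _ [k [B [BW Bk [x Bx]]] <-]; rewrite lee_fin lerD2r lez_nat.
apply: leq_trans (Wn x); rewrite -card_le_II.
rewrite -(card_le_eql Bk).
(* [nth] on the list of the [W j] through [x] maps [I_(mult W x)] onto a set containing [B];
   repetitions in the list are harmless. *)
apply: card_le_trans
  (card_image_le (nth set0 (map W (enum [pred j | x \in W j]))) _).
apply: subset_card_le => X BX; have [j _ WjX] := BW _ BX.
have jx : j \in enum [pred j | x \in W j].
  by rewrite mem_enum !inE WjX; exact: Bx.
exists (index j (enum [pred j | x \in W j])) => /=.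
  by rewrite /mult cardE index_mem.
by rewrite (nth_map j) ?index_mem// nth_index.
Qed.

(** Swelling [K] makes it open without creating new intersections, and multiplicity at most [n]
    means order at most [n - 1]. *)
Lemma covdim_le_closed_covers {R : realType} {M : metricType R} {n : nat} :
    compact [set: M] ->
    (forall (J : finType) (U : J -> set M), (forall j, open (U j)) ->
        (forall x, exists j, U j x) ->
      exists K : J -> set M,
        [/\ forall j, closed (K j), forall j, K j `<=` U j,
            forall x, exists j, K j x & forall x, (mult K x <= n)%N]) ->
  covdim_le M (n%:Z - 1).
Proof.
move=> cM HK U [/finite_seqP[s Us] oU covU].
pose u (j : 'I_(size s)) := nth set0 s j.
have sU j : U (u j) by rewrite Us /=; exact: mem_nth.
have [|x|K [cK KU covK Kn]] := HK _ u.
- by move=> j; exact: oU.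
- have : (\bigcup_(X in U) X) x by rewrite covU.
  case=> Y; rewrite Us /= => sY Yx; move: (sY); rewrite -index_mem => lts.
  by exists (Ordinal lts); rewrite /u nth_index.
have [W [oW KW WU Wy]] := closed_swell cM closed0 cK (fun j => oU _ (sU j)) KU.
exists (range W); split.
- split; first by apply: finite_image; exact: finite_finset.
    by move=> _ [j _ <-].
  rewrite -subTset => x _; have [j /KW Wjx] := covK x.
  by exists (W j) => //; exists j.
- by move=> _ [j _ <-]; exists (u j) => // x /subset_closure/WU.
- apply: family_order_range => x; have [y [_ Wy']] := Wy x.
  by apply: leq_trans (Kn y); apply: mult_le => j /subset_closure/Wy'.
Qed.

(** * Fibres of a map without long alternations *)

Lemma exists_notin_countable {R : realType} {D : set R} {a b : R} :
  countable D -> a < b -> exists2 t, a < t < b & ~ D t.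
Proof.
move=> cD ab; apply: contrapT => nt.
have sub : `]a, b[%classic `<=` D.
  move=> t /=; rewrite in_itv/= => atb; apply: contrapT => nDt; apply: nt.
  by exists t.
(* A countable set is Lebesgue null, while the interval has measure [b - a]. *)
have := countable_lebesgue_measure0 (sub_countable (subset_card_le sub) cD).
rewrite lebesgue_measure_itv/= lte_fin ab -EFinB => -[].
by move/eqP; rewrite subr_eq0 => /eqP ba; rewrite ba ltxx in ab.
Qed.

Definition has_alternation {R : realType} {M : Type} (A : set R) (f : R -> M)
    (n : nat) : Prop :=
  exists x : 'I_n.+1 -> R,
    [/\ forall i, A (x i),
        forall i j : 'I_n.+1, (i < j)%N -> x i < x j,
        forall i j : 'I_n.+1, ~~ odd i -> ~~ odd j -> f (x i) = f (x j)
      & forall i j : 'I_n.+1, odd i -> odd j -> f (x i) = f (x j)].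

Lemma has_alternation_nat {R : realType} {M : Type} {A : set R} {f : R -> M}
    {n : nat} (z : nat -> R) (a b : M) :
    (forall m, (m <= n)%N -> A (z m)) ->
    (forall l m, (l < m <= n)%N -> z l < z m) ->
    (forall m, (m <= n)%N -> f (z m) = if odd m then b else a) ->
  has_alternation A f n.
Proof.
move=> zA zlt fz; have leI (i : 'I_n.+1) : (i <= n)%N by rewrite -ltnS ltn_ord.
exists (fun i => z i); split=> [i|i j ij|i j|i j].
- exact: zA.
- by apply: zlt; rewrite ij leI.
- by move=> /negbTE oi /negbTE oj; rewrite !fz// oi oj.
- by move=> oi oj; rewrite !fz// oi oj.
Qed.

Definition fibre_seq {R : realType} {M : Type} (A : set R) (f : R -> M) (y : M)
    (s : seq R) : Prop :=
  uniq s /\ forall x, x \in s -> A x /\ f x = y.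

Lemma fibre_seq_nth {R : realType} {M : Type} {A : set R} {f : R -> M} {y : M}
    {s : seq R} (x := fun i => nth 0 (sort <=%R s) i) :
    fibre_seq A f y s ->
  (forall l, (l < size s)%N -> A (x l) /\ f (x l) = y) /\
  (forall l m, (l < m < size s)%N -> x l < x m).
Proof.
move=> [us sy]; split=> [l ls|l m /andP[lm ms]].
  by apply: sy; rewrite -(mem_sort <=%R) mem_nth// size_sort.
apply: (sorted_ltn_nth lt_trans); rewrite ?inE ?size_sort//.
- by rewrite sort_lt_sorted.
- exact: ltn_trans ms.
Qed.

Lemma fibre_seq_size {R : realType} {M : Type} {A : set R} {f : R -> M}
    {n : nat} {y : M} {s : seq R} :
  ~ has_alternation A f n -> fibre_seq A f y s -> (size s <= n)%N.
Proof.
move=> nalt /fibre_seq_nth[sA slt]; rewrite leqNgt; apply/negP => ns; apply: nalt.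
apply: (has_alternation_nat (nth 0 (sort <=%R s)) y y) =>
  [m mn|l m /andP[lm mn]|m mn].
- by apply sA; exact: leq_ltn_trans ns.
- by apply: slt; rewrite lm (leq_ltn_trans mn).
- by rewrite if_same; apply sA; exact: leq_ltn_trans ns.
Qed.

(* The p.2-th point of an increasing n-tuple in a fibre of f whose consecutive
   points are separated by the rationals of p.1. *)
Definition separated_fibre {R : realType} {M : Type} (A : set R) (f : R -> M)
    (n : nat) (p : seq rat * nat) : set R :=
  [set t | (p.2 < n)%N /\ exists x : nat -> R,
    [/\ x p.2 = t, forall l, (l < n)%N -> A (x l) /\ f (x l) = f t,
        forall l, (l < n)%N -> x l < ratr (nth 0 p.1 l)
      & forall l m, (l < m < n)%N -> ratr (nth 0 p.1 l) < x m]].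

Lemma separated_fibre_inj {R : realType} {M : Type} {A : set R} {f : R -> M}
    {n : nat} {p : seq rat * nat} {t t' : R} :
    ~ has_alternation A f n ->
  separated_fibre A f n p t -> separated_fibre A f n p t' -> t = t'.
Proof.
move=> nalt; wlog tt' : t t' / t < t'.
  move=> H St St'; case: (ltgtP t t') => // lt; first exact: H.
  by apply/esym/H.
case: p => q i [/= ni [x [xi xA xq qx]]] [_ [x' [xi' xA' xq' qx']]].
(* Following the two fibres alternately, one point per separated slot but both
   t and t' in the i-th slot, gives n+1 points. *)
case: nalt; pose g (m : nat) := if odd m == odd i then x else x'.
have gA m l : (l < n)%N ->
    A (g m l) /\ f (g m l) = if odd m == odd i then f t else f t'.
  by move=> ln; rewrite /g; case: ifP => _; [exact: xA | exact: xA'].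
have cross k k' l m : (l < m < n)%N -> g k l < g k' m.
  move=> /andP[lm mn]; have ln := ltn_trans lm mn.
  apply: (@lt_trans _ _ (ratr (nth 0 q l))).
    by rewrite /g; case: ifP => _; [exact: xq | exact: xq'].
  by rewrite /g; case: ifP => _; [apply: qx | apply: qx']; rewrite lm.
(* Slot [i] is visited twice, at [m = i] and at [m = i.+1]; the parity test in [g] makes these two
   points [t] and [t'], in increasing order. *)
apply: (has_alternation_nat (fun m => g m (if (m <= i)%N then m else m.-1))
  (if odd i then f t' else f t) (if odd i then f t else f t')) =>
  [m mn|l m /andP[lm mn]|m mn].
- by apply gA; case: ifP; lia.
- case: (leqP m i) => mi.
    rewrite (leq_trans (ltnW lm) mi); apply: cross; lia.
  case: (leqP l i) => li; last by apply: cross; lia.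
  case: (ltnP l m.-1) => lm1; first by apply: cross; lia.
  have [-> ->] : l = i /\ m = i.+1 by lia.
  by rewrite /g /= eqxx; case: (odd i) => /=; rewrite xi xi'.
- rewrite (gA m _ _).2; last by case: ifP; lia.
  by case: (odd m); case: (odd i).
Qed.

(** Without an alternation no fibre has more than [n] points, so such an [s] is the whole fibre. *)
Definition full_fibre_points {R : realType} {M : Type} (A : set R) (f : R -> M)
    (n : nat) : set R :=
  [set t | exists s, [/\ fibre_seq A f (f t) s, t \in s & size s = n]].

(** Every such point is caught by some pair of a rational list and a position; there are countably
    many pairs, and each catches at most one point. *)
Lemma countable_full_fibre_points {R : realType} {M : Type} {A : set R}
    {f : R -> M} {n : nat} :
  ~ has_alternation A f n -> countable (full_fibre_points A f n).
Proof.
move=> nalt.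
have cS : countable (\bigcup_p separated_fibre A f n p).
  apply: bigcup_countable => // p _.
  have [->|/set0P[t St]] := eqVneq (separated_fibre A f n p) set0.
    exact: countable0.
  apply: sub_countable (countable1 t); apply: subset_card_le => t' St' /=.
  exact: separated_fibre_inj St' St.
apply: sub_countable cS; apply: subset_card_le => t [s [sy ts sn]].
have [sA slt] := fibre_seq_nth sy; rewrite sn in sA slt.
set x := fun i => nth 0 (sort <=%R s) i in sA slt.
(* The last point has no successor, so [x l + 1] serves as its upper bound; the second disjunct only
   makes the choice total. *)
have exq l : exists q : rat,
    x l < ratr q < (if (l.+1 < n)%N then x l.+1 else x l + 1) \/ ~ (l < n)%N.
  case: (ltnP l n) => ln; last by exists 0; right.
  have [|q] := @rat_in_itvoo R (x l) (if (l.+1 < n)%N then x l.+1 else x l + 1).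
    by case: ifP => l1n; [apply: slt; rewrite ltnSn | rewrite ltrDl].
  by rewrite in_itv /= => xq; exists q; left.
have [q xq] := choice exq.
have xq' l : (l < n)%N ->
    x l < ratr (q l) /\ forall m, (l < m < n)%N -> ratr (q l) < x m.
  move=> ln; have [/andP[xl qx]|//] := xq l; split=> // m /andP[lm mn].
  apply: lt_le_trans qx _; rewrite (leq_ltn_trans lm mn).
  have [->//|lm'] := eqVneq l.+1 m.
  by apply/ltW/slt; rewrite mn andbT ltn_neqAle lm'.
exists (mkseq q n, index t (sort <=%R s)) => //; split=> /=.
  by rewrite -sn -(size_sort <=%R) index_mem mem_sort.
exists x; split=> [|//|l ln|l m /andP[lm mn]] /=.
- by rewrite /x nth_index// mem_sort.
- by rewrite nth_mkseq//; apply xq'.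
- have ln := ltn_trans lm mn.
  by rewrite nth_mkseq//; apply xq' => //; rewrite lm.
Qed.

Lemma finite_fibre {R : realType} {M : Type} {A : set R} {f : R -> M}
    {n : nat} (y : M) :
  ~ has_alternation A f n -> finite_set [set x | A x /\ f x = y].
Proof.
move=> nalt; apply: contrapT => /(infinite_set_fset n.+1)[B By].
rewrite ltnNge => /negP; apply; apply: (fibre_seq_size nalt).
split; [exact: finmap.fset_uniq | exact: By].
Qed.

(** * Cutting a segment at generic points *)

Lemma exists_cuts {R : realType} {M : Type} {A : set R} {f : R -> M} {n : nat}
    (a d : R) (N : nat) :
    ~ has_alternation A f n -> 0 < d ->
  exists t : nat -> R,
    [/\ forall i, (i < N)%N -> a + d * i%:R < t i < a + d * i.+1%:R,
        forall i, (i < N)%N -> ~ full_fibre_points A f n (t i)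
      & forall i j, (i < j < N)%N -> A (t i) -> A (t j) -> f (t i) <> f (t j)].
Proof.
move=> nalt d0; elim: N => [|N [t [tb tD tf]]].
  by exists (fun=> 0); split=> // i j; rewrite ltn0 andbF.
(* The new cut must avoid the full fibres and also the fibres of the earlier cuts, which are
   finite. *)
pose D := full_fibre_points A f n `|`
  \bigcup_(i in `I_N) [set x | A x /\ f x = f (t i)].
have cD : countable D.
  rewrite /D -bigcup2E; apply: bigcup_countable => // -[|[|i]] _ //=.
    exact: countable_full_fibre_points.
  apply: bigcup_countable => // i _; apply: finite_set_countable.
  exact: finite_fibre nalt.
have [|x xb Dx] := @exists_notin_countable R D (a + d * N%:R) (a + d * N.+1%:R) cD.
  by rewrite ltrD2l ltr_pM2l// ltr_nat.
exists (fun i => if i == N then x else t i); split=> [i|i|i j /andP[ij]].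
- by rewrite ltnS leq_eqVlt; case: eqP => [->//|_ /=]; exact: tb.
- rewrite ltnS leq_eqVlt; case: eqP => [_ _ Fx|_ /=]; last exact: tD.
  by apply: Dx; left.
- rewrite ltnS leq_eqVlt; case: eqP ij => [-> iN _|_ ij /= jN].
    rewrite (ltn_eqF iN) => _ Ax fx; apply: Dx; right; exists i => //=.
  by rewrite (ltn_eqF (ltn_trans ij jN)); apply: tf; rewrite ij.
Qed.

Definition cut_piece {R : realType} {M : Type} (A : set R) (f : R -> M)
    (t : nat -> R) (i : nat) : set M :=
  f @` (A `&` [set x | t i <= x <= t i.+1]).

Lemma mult_pieces {R : realType} {M : Type} {A : set R} {f : R -> M} {n N : nat}
    {t : nat -> R} :
    ~ has_alternation A f n ->
    (forall i j, (i < j < N)%N -> t i < t j) ->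
    (forall i, (i < N)%N -> ~ full_fibre_points A f n (t i)) ->
    (forall i j, (i < j < N)%N -> A (t i) -> A (t j) -> f (t i) <> f (t j)) ->
  forall y, (mult (fun i : 'I_N => cut_piece A f t i) y <= n)%N.
Proof.
move=> nalt tlt tD tf y; rewrite /mult; set S := [pred i | _].
have exp (i : 'I_N) : exists x, S i -> [/\ A x, f x = y & t i <= x <= t i.+1].
  case: (boolP (S i)) => [|_]; last by exists 0.
  by rewrite inE => -[x [Ax xt] fx]; exists x.
have [p pP] := choice exp.
(* Pieces overlap only at cut points, so p repeats a value only at a cut. *)
have pS (i j : 'I_N) : S i -> S j -> (i < j)%N -> p i = p j ->
    A (t j) /\ f (t j) = y.
  move=> Si Sj ij pij; have [_ _ /andP[_ pi]] := pP i Si.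
  have [Ap fp /andP[pj _]] := pP j Sj.
  suff -> : t j = p j by [].
  apply/eqP; rewrite eq_le pj -pij (le_trans pi)//.
  case: (ltngtP i.+1 j) ij => // [ij|-> //] _.
  by apply/ltW/tlt; rewrite ij /=.
have fibp (T : pred 'I_N) : (forall i, T i -> S i) ->
    fibre_seq A f y (undup (map p (enum T))).
  move=> TS; split; first exact: undup_uniq.
  by move=> _ /[!mem_undup]/mapP[i /[!mem_enum] Ti ->]; have [] := pP i (TS i Ti).
(* When no cut indexed by [T] lies over [y], the picks [p i] are distinct, so the fibre list counts
   [T] exactly. *)
have sizep (T : pred 'I_N) : (forall i, T i -> S i) ->
    (forall j, T j -> ~ (A (t j) /\ f (t j) = y)) ->
    size (undup (map p (enum T))) = #|T|.
  move=> TS nT; rewrite undup_id ?size_map ?cardE//.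
  rewrite map_inj_in_uniq ?enum_uniq// => i j; rewrite !mem_enum => Ti Tj pij.
  apply/eqP/negP => /negP nij; wlog ij : i j Ti Tj pij nij / (i < j)%N.
    move=> H; move: (nij); rewrite -val_eqE neq_ltn => /orP[ij|ji].
      exact: (H i j).
    by apply: (H j i) => //; rewrite eq_sym.
  by apply: (nT j Tj); apply: pS pij => //; exact: TS.
have [[c [Ac fc]]|nc] :=
    pselect (exists c : 'I_N, A (t c) /\ f (t c) = y); last first.
  rewrite -(sizep S) => [|//|j _ tj]; last by apply: nc; exists j.
  by apply: fibre_seq_size nalt (fibp S _).
(* At most one cut c meets the fibre of y; then the fibre has fewer than n points,
   which compensates for the single repetition. *)
pose T := [pred i | (i != c) && S i].
have TS i : T i -> S i by case/andP.
have nT j : T j -> ~ (A (t j) /\ f (t j) = y).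
  case/andP=> + _ [Aj fj]; rewrite -val_eqE neq_ltn => /orP[jc|cj].
    by apply: (tf j c) => //; [rewrite jc /= | rewrite fj].
  by apply: (tf c j) => //; [rewrite cj /= | rewrite fj].
have ST : (#|S| <= #|T|.+1)%N.
  rewrite (cardD1 c); apply: (@leq_add _ _ 1); first exact: leq_b1.
  by apply/subset_leq_card/fintype.subsetP => i; rewrite !inE.
apply: leq_trans ST _; rewrite -(sizep T TS nT).
have [us sy] := fibp T TS; set s := undup _ in us sy *.
(* If [t c] is in [s], length [n] would put the cut on a full fibre; otherwise [t c] can be added to
   [s]. Either way [s] has fewer than [n] points. *)
case: (boolP (t c \in s)) => cs.
  rewrite ltn_neqAle (fibre_seq_size nalt (conj us sy)) andbT; apply/eqP => sn.
  by apply: (tD c) => //; exists s; split=> //; rewrite fc.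
apply: (@fibre_seq_size _ _ _ _ _ y (t c :: s) nalt); split; first by rewrite /= cs.
by move=> x; rewrite in_cons => /predU1P[->//|]; exact: sy.
Qed.

Lemma uniform_fineness {R : realType} {M : topologicalType} {J : Type} {A B : set R}
    {f : R -> M} {U : J -> set M} :
    closed A -> {within A, continuous f} -> compact B ->
    (forall j, open (U j)) -> (forall x, exists j, U j x) ->
  exists2 e : R, 0 < e &
    forall x, B x -> exists j, forall z, A z -> `|x - z| < e -> U j (f z).
Proof.
move=> clA /subspace_continuousP fcont cB oU covU.
pose Q (C : set R) := exists j, forall z, C z -> A z -> U j (f z).
have [C D CD [j UD]|x _|e e0 Qe] := @lebesgue_number R R B Q cB.
- by exists j => z /CD; exact: UD.
- have [Ax|nAx] := pselect (A x).
    have [j Ujx] := covU (f x).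
    exists [set z | A z -> U j (f z)]; last by exists j => z.
    by apply: (fcont x Ax); apply: open_nbhs_nbhs; split.
  (* Off [A] the condition is vacuous and any index serves. *)
  exists (~` A); first by apply: open_nbhs_nbhs; split=> //; exact: closed_openC.
  by have [j _] := covU (f x); exists j.
exists e => // x /Qe[j Uj]; exists j => z Az xz; exact: Uj.
Qed.

(** Each short piece is assigned to one [U j] containing it, and [G j] collects the pieces assigned
    to [j]; grouping cannot raise the multiplicity. *)
Lemma closed_cover_segment {R : realType} {M : metricType R} {J : finType}
    {A : set R} {f : R -> M} {n : nat} {U : J -> set M} (k : R) :
    closed A -> {within A, continuous f} -> ~ has_alternation A f n ->
    (forall j, open (U j)) -> (forall x, exists j, U j x) ->
  exists G : J -> set M,
    [/\ forall j, closed (G j), forall j, G j `<=` U j,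
        forall x, A x -> - k <= x <= k -> exists j, G j (f x)
      & forall y, (mult G y <= n)%N].
Proof.
move=> clA fcont nalt oU covU.
have [e e0 He] := uniform_fineness clA fcont (@segment_compact R (- k) k) oU covU.
have d0 : 0 < e / 2 by rewrite divr_gt0.
(* Neighbouring cuts will be less than [2 * d = e] apart, and the first one falls in []- k - d, -
   k[], to the left of the segment. *)
set d := e / 2 in d0; pose a := - k - d.
have [N Nk] : exists N : nat, k < a + d * N%:R.
  exists (Num.truncn ((k - a) / d)).+1.
  by rewrite -ltrBlDl mulrC -ltr_pdivrMr// truncnS_gt.
have [t [tb tD tf]] := exists_cuts a d N.+1 nalt d0.
have tlt i j : (i < j < N.+1)%N -> t i < t j.
  move=> /andP[ij jN]; have /andP[_ ti] := tb i (ltn_trans ij jN).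
  have /andP[tj _] := tb j jN; apply: lt_trans ti (le_lt_trans _ tj).
  by rewrite lerD2l ler_pM2l// ler_nat.
pose B := A `&` `[- k, k].
have cB : compact B.
  by rewrite /B setIC; apply: compact_closedI => //; exact: segment_compact.
have clP i : closed (cut_piece B f t i).
  apply: compact_closed; first exact: metric_hausdorff.
  apply: continuous_compact.
    by apply: continuous_subspaceW fcont => x [[]].
  apply: compact_closedI => //.
  have -> : [set x | t i <= x <= t i.+1] = `[t i, t i.+1]%classic.
    by apply/seteqP; split=> x; rewrite /= in_itv.
  exact: itv_closed.
have exs (i : 'I_N) : exists j, cut_piece B f t i `<=` U j.
  have [[x [[Ax xk] /= xt]]|nx] :=
    pselect (exists x, (B `&` [set x | t i <= x <= t i.+1]) x); last first.
    have [j _] := covU (f 0); exists j => y [x Bx _]; case: nx; by exists x.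
  have [j Uj] := He x xk; exists j => _ [z [[Az _] /= zt] <-].
  apply: Uj => //.
  have /andP[ti _] := tb i (ltnW (ltn_ord i)).
  have /andP[_ ti1] := tb i.+1 (ltn_ord i).
  have ee : e = d + d by rewrite /d -splitr.
  have : t i.+1 - t i < e.
    move: ti ti1; rewrite -!natr1 !mulrDr mulr1 ee; lra.
  by rewrite ltr_norml; lra.
have [s sP] := choice exs.
pose G j := \bigcup_(i in [set i | s i = j]) cut_piece B f t i.
exists G; split.
- by move=> j; apply: closed_bigcup => // ; exact: finite_finset.
- by move=> j y [i /= <-]; exact: sP.
- move=> x Ax /[dup] xk /andP[kx xk'].
  have t0 : t 0 < x.
    have /andP[_] := tb 0%N isT; rewrite mulr1 /a subrK => /lt_le_trans; exact.
  have exm : exists m, x <= t m.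
    exists N; have /andP[/ltW tN _] := tb N (ltnSn N).
    by apply: le_trans tN; apply: le_trans xk' (ltW Nk).
  (* The first cut not left of [x] has positive index, so [x] lies in the piece ending there. *)
  have [m xm mmin] := ex_minnP exm.
  case: m => [|m] in xm mmin *.
    by rewrite leNgt t0 in xm.
  have mN : (m < N)%N.
    apply: mmin; have /andP[/ltW tN _] := tb N (ltnSn N).
    by apply: le_trans tN; apply: le_trans xk' (ltW Nk).
  exists (s (Ordinal mN)), (Ordinal mN) => //; exists x => //; split => //=.
  rewrite xm andbT leNgt; apply/negP => /ltW /mmin; by rewrite ltnn.
- move=> y.
  have tD' i : (i < N)%N -> ~ full_fibre_points A f n (t i).
    by move=> iN; apply: tD; exact: ltnW.
  have tlt' i j : (i < j < N)%N -> t i < t j.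
    by move=> /andP[ij jN]; apply: tlt; rewrite ij ltnW.
  have tf' i j : (i < j < N)%N -> A (t i) -> A (t j) -> f (t i) <> f (t j).
    by move=> /andP[ij jN]; apply: tf; rewrite ij ltnW.
  (* The cuts are generic for [A], so the bound is taken for the pieces of [A], which contain those
     of [B]. *)
  apply: leq_trans (mult_pieces nalt tlt' tD' tf' y).
  apply: leq_trans (leq_image_card s _).
  apply/subset_leq_card/fintype.subsetP => j; rewrite !inE => -[i /= <-].
  move=> [x [[Ax _] xt] fx]; apply: fintype.image_f; rewrite !inE.
  by exists x.
Qed.

(** * Shrinking open covers and the countable closed sum *)

Lemma closed_shrinking {R : realType} {M : metricType R} {J : Type}
    {U : J -> set M} :
    compact [set: M] -> (forall j, open (U j)) -> (forall x, exists j, U j x) ->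
  exists E : J -> set M,
    [/\ forall j, closed (E j), forall j, E j `<=` U j
      & forall x, exists j, E j x].
Proof.
move=> cM oU covU.
have [B C BC [j CU]|x _|e e0 He] :=
  @lebesgue_number R M _ (fun B => exists j, B `<=` U j) cM.
- by exists j; exact: subset_trans BC CU.
- have [j Ujx] := covU x; exists (U j); last by exists j.
  exact: open_nbhs_nbhs.
exists (fun j => closure [set x | ball x e `<=` U j]); split=> [j|j x|x].
- exact: closed_closure.
- move=> /(_ _ (nbhsx_ballx x e e0))[y [yU xy]]; apply: yU; exact: ball_sym.
- by have [j xU] := He x I; exists j; exact: subset_closure.
Qed.

(** Near the union [F] of the [G j] the cover is replaced by a swelling of [G]; the closed shrinking
    [E] is used only away from [F]. *)
Lemma shrink_open_cover {R : realType} {M : metricType R} {J : finType}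
    {G U : J -> set M} :
    compact [set: M] -> (forall j, open (U j)) -> (forall x, exists j, U j x) ->
    (forall j, closed (G j)) -> (forall j, G j `<=` U j) ->
  exists V : J -> set M,
    [/\ forall j, open (V j), forall x, exists j, V j x,
        forall j, closure (V j) `<=` U j
      & forall x, (exists j, G j x) ->
          exists y, (mult (fun j => closure (V j)) x <= mult G y)%N].
Proof.
move=> cM oU covU cG GU; have [E [cE EU covE]] := closed_shrinking cM oU covU.
have [W [oW GW WU Wy]] := closed_swell cM closed0 cG oU GU.
pose F := \bigcup_j G j.
have cF : closed F by apply: closed_bigcup => //; exact: finite_finset.
have oO : open (\bigcup_j W j) by exact: bigcup_open.
have FO : F `<=` \bigcup_j W j by move=> x [j _ /GW]; exists j.
(* Swelling a one-member family gives normality: [N tt] is open, contains [F], and its closure lies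
   in the union of the [W j]. *)
have [N [oN FN NO _]] := @closed_swell R M unit set0 (fun=> F)
  (fun=> \bigcup_j W j) cM closed0 (fun=> cF) (fun=> oO) (fun=> FO).
pose H j := closure (W j) `|` (E j `&` ~` N tt).
have cH j : closed (H j).
  apply: closedU; first exact: closed_closure.
  by apply: closedI => //; exact: open_closedC.
have HU j : H j `<=` U j by move=> x [/WU|[/EU]].
(* Tracking [F] keeps the witness of a point of [F] inside [F], where only the part [closure (W j)]
   of [H j] is present. *)
have [V [oV HV VU Vy]] := closed_swell cM cF cH oU HU.
exists V; split=> // x.
- have [Nx|nNx] := pselect (N tt x).
    have [j _ Wjx] := NO tt x (subset_closure Nx).
    by exists j; apply: HV; left; exact: subset_closure.
  by have [j Ejx] := covE x; exists j; apply: HV; right.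
- move=> [j Gjx]; have [y [Fy Hy]] := Vy x; have [z [_ Gz]] := Wy y; exists z.
  apply: mult_le => i /Hy [/Gz//|[_]].
  by case; apply: (FN tt); apply: Fy; exists j.
Qed.

Lemma closed_cover_of_exhaustion {M : topologicalType} {J : finType} {n : nat}
    {P : nat -> set M} {U : J -> set M} :
    (forall x, exists k, P k x) ->
    (forall (U : J -> set M) (k : nat),
        (forall j, open (U j)) -> (forall x, exists j, U j x) ->
      exists V : J -> set M,
        [/\ forall j, open (V j), forall x, exists j, V j x,
            forall j, closure (V j) `<=` U j
          & forall x, P k x -> (mult (fun j => closure (V j)) x <= n)%N]) ->
    (forall j, open (U j)) -> (forall x, exists j, U j x) ->
  exists K : J -> set M,
    [/\ forall j, closed (K j), forall j, K j `<=` U j,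
        forall x, exists j, K j x & forall x, (mult K x <= n)%N].
Proof.
move=> covP step oU covU.
pose cover (V : J -> set M) :=
  (forall j, open (V j)) /\ (forall x, exists j, V j x).
have exV (p : (J -> set M) * nat) : exists V : J -> set M, cover p.1 ->
    [/\ cover V, forall j, closure (V j) `<=` p.1 j
      & forall x, P p.2 x -> (mult (fun j => closure (V j)) x <= n)%N].
  case: p => V k; have [[oV covV]|nV] := pselect (cover V); last by exists V.
  by have [V' [? ? ? ?]] := step V k oV covV; exists V'.
have [next nextP] := choice exV.
(* Stage [k.+1] controls the multiplicity on [P k]; later stages only shrink, so the bound passes to
   the intersection. *)
pose fix u k := if k is k'.+1 then next (u k', k') else U.
have cu k : cover (u k) by elim: k => [//|k IH] /=; have [] := nextP (u k, k) IH.
have clu k j : closure (u k.+1 j) `<=` u k j.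
  by have [_ H _] := nextP (u k, k) (cu k); exact: H.
have umono k l j : (k <= l)%N -> u l j `<=` u k j.
  elim: l => [|l IH]; first by rewrite leqn0 => /eqP->.
  rewrite leq_eqVlt => /predU1P[->//|/IH]; apply: subset_trans.
  by move=> x /subset_closure/clu.
exists (fun j => \bigcap_k closure (u k.+1 j)); split=> [j|j x|x|x].
- by apply: closed_bigI => k _; exact: closed_closure.
- by move=> /(_ 0%N I)/clu.
(* If [x] left the [j]-th closures at stage [k j] for every [j], then, [J] being finite, a later
   stage would fail to cover [x]. *)
- apply: contrapT => nx.
  have exk j : exists k, ~ closure (u k.+1 j) x.
    apply: contrapT => nk; apply: nx; exists j => k _.
    by apply: contrapT => nk'; apply: nk; exists k.
  have [k kP] := choice exk.
  have [_ /(_ x) [j ujx]] := cu (\max_j k j).+1.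
  apply: (kP j); apply: subset_closure; apply: umono ujx.
  by rewrite ltnS leq_bigmax.
- have [k Pkx] := covP x; have [_ _ /(_ x Pkx)] := nextP (u k, k) (cu k).
  by apply: leq_trans; apply: mult_le => j; apply.
Qed.

Theorem proposition1p5 (R : realType) (n : nat) (M : metricType R)
    (cptM : compact [set: M]) (dimM : (n%:Z%:E <= covdim M)%E)
    (A : set R) (clA : closed A) (f : R -> M)
    (fcont : {within A, continuous f}) (fonto : f @` A = [set: M]) :
  exists x : 'I_n.+1 -> R,
    [/\ forall i, A (x i),
        forall i j : 'I_n.+1, (i < j)%N -> x i < x j,
        forall i j : 'I_n.+1, ~~ odd i -> ~~ odd j -> f (x i) = f (x j)
      & forall i j : 'I_n.+1, odd i -> odd j -> f (x i) = f (x j)].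
Proof.
apply: contrapT => nalt.
suff /covdim_le_bound/(le_trans dimM) : covdim_le M (n%:Z - 1).
  by rewrite lee_fin; lia.
apply: covdim_le_closed_covers => // J U oU covU.
(* These images exhaust [M] because [f] is onto, even when [A] is unbounded. *)
pose P (k : nat) := f @` (A `&` [set x | - k%:R <= x <= k%:R]).
apply: (@closed_cover_of_exhaustion _ _ _ P) => // [y|V k oV covV].
  have [x Ax <-] : (f @` A) y by rewrite fonto.
  exists (Num.truncn `|x|).+1; exists x => //; split=> //=.
  by rewrite -ler_norml ltW// truncnS_gt.
have [G [cG GV covG Gn]] := closed_cover_segment k%:R clA fcont nalt oV covV.
have [W [oW covW WV Wn]] := shrink_open_cover cptM oV covV cG GV.
exists W; split=> // _ [x [Ax xk] <-].
by have [y] := Wn _ (covG x Ax xk); move=> /leq_trans; apply.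
Qed.
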